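(* Consider either the Kagome or the Rotating Squares metamaterial, let $\eta>0$ and $k\in\mathbb N$, $k\geq 1$. If $u(x)=\lambda x+\psi(x)$ is a $k$-periodic mechanism, then its macroscopic deformation $\lambda$ is an isotropic compression, i.e. $\lambda=cR$ for some $0\le c\le1$ and $R\in SO(2)$.
   Context: Kagome metamaterial. Lattice vectors $v_1=(2,0)^T$, $v_2=(1,\sqrt3)^T$. Points $O=(0,0)$, $A=(\tfrac12,\tfrac{\sqrt3}{2})$, $B=(-\tfrac12,\tfrac{\sqrt3}{2})$, $C=(-\tfrac12,-\tfrac{\sqrt3}{2})$, $D=(\tfrac12,-\tfrac{\sqrt3}{2})$, $E=(\tfrac32,-\tfrac{\sqrt3}{2})$, $F=(\tfrac32,\tfrac{\sqrt3}{2})$. The unit cell $U$ is the rectangle with vertices $B,C,E,F$; the basic set of nodes is $V=\{A,O,D\}$. The spring energy is $$E_{\rm spr}(u,U)=\sum_{(P,Q)}\big(|u(P)-u(Q)|-|P-Q|\big)^2,$$ the sum being over the six springs $AO,BO,CO,DO,AF,DE$. The penalized triangles are $\Delta AOB$ and $\Delta COD$. Rotating Squares metamaterial. Lattice vectors $v_1=(2,0)^T$, $v_2=(0,2)^T$. Points $A=(-1,1)$, $B=(0,1)$, $C=(1,1)$, $D=(-1,0)$, $O=(0,0)$, $E=(1,0)$, $F=(-1,-1)$, $G=(0,-1)$, $H=(1,-1)$. The unit cell $U$ is the square with vertices $A,C,H,F$; the basic set of nodes is $V=\{O,A,B,D\}$. The spring energy is $$E_{\rm spr}(u,U)=\sum_{(P,Q)}c_{PQ}\big(|u(P)-u(Q)|-|P-Q|\big)^2,$$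 the sum being over the ten springs $AB,AO,AD,BC,BO,DO,EO,DF,OG,OH$, with $c_{PQ}=2$ for the diagonal springs $AO,OH$ and $c_{PQ}=1$ for the other eight. The penalized triangles are $\Delta AOB,\Delta AOD,\Delta EOH,\Delta GOH$. For both: the set of nodes is $\mathcal V=\bigcup_{\alpha_1,\alpha_2\in\mathbb Z}(V+\alpha_1v_1+\alpha_2v_2)$. A deformation is a function $u:\mathcal V\to\mathbb R^2$. For a triangle $T$ with vertices in $\mathcal V$, $Du|_T$ is the (constant) gradient of the affine interpolant of $u$ on $T$, and $|T|$ is its area. For $\eta>0$ put $f^\eta(t)=1/\eta$ for $t\le 0$, $f^\eta(t)=0$ for $t>0$, and $$E^\eta(u,U)=E_{\rm spr}(u,U)+\sum_{T}|T|\,f^\eta(\det Du|_T),$$ the sum being over the penalized triangles. For $\alpha=\alpha_1v_1+\alpha_2v_2$ with $\alpha_1,\alpha_2\in\mathbb Z$, $E^\eta(u,U+\alpha):=E^\eta(u(\cdot+\alpha),U)$. Periodic mechanism. A deformation $u(x)=\lambda x+\psi(x)$, $x\in\mathcal V$, is a $k$-periodic mechanism achieving macroscopic deformation $\lambda$ if (a) $\lambda\in\mathbb R^{2\times2}$; (b) $\psi:\mathcal V\to\mathbb R^2$ is $k$-periodic, i.e. $\psi(x+kv_1)=\psi(x+kv_2)=\psi(x)$ for all $x\in\mathcal V$; (c) $E^\eta(u,U+\alpha_1v_1+\alpha_2v_2)=0$ for every $(\alpha_1,\alpha_2)\in\mathbb Z^2$. *)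

(* Defs.v *)
From HB Require Import structures.
From mathcomp Require Import all_boot all_order all_algebra.
From mathcomp Require Import boolp classical_sets reals.

Set Implicit Arguments.
Unset Strict Implicit.
Unset Printing Implicit Defensive.

Import Order.TTheory GRing.Theory Num.Theory.
Local Open Scope classical_set_scope.
Local Open Scope ring_scope.

Section Plane.
Variable R : realType.
Implicit Types (u : 'cV[R]_2 -> 'cV[R]_2) (P Q S : 'cV[R]_2).

Definition pt (x y : R) : 'cV[R]_2 := \col_i (if i == 0 then x else y).

(* Euclidean norm; the library norm on matrices is the sup norm. *)
Definition enorm P : R := Num.sqrt (\sum_i P i 0 ^+ 2).

Record spring := Spring {
  stiffness : R; spring_src : 'cV[R]_2; spring_tgt : 'cV[R]_2 }.

Record triangle := Triangle {
  vertex0 : 'cV[R]_2; vertex1 : 'cV[R]_2; vertex2 : 'cV[R]_2 }.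

Definition edge_mx P Q S : 'M[R]_2 := row_mx (Q - P) (S - P).

Definition area (T : triangle) : R :=
  `|\det (edge_mx (vertex0 T) (vertex1 T) (vertex2 T))| / 2.

(* Gradient of the affine interpolant of u on T: the only matrix that maps the
   edge vectors of T to those of its image (see grad_affine). *)
Definition grad u (T : triangle) : 'M[R]_2 :=
  edge_mx (u (vertex0 T)) (u (vertex1 T)) (u (vertex2 T)) *m
  invmx (edge_mx (vertex0 T) (vertex1 T) (vertex2 T)).

Lemma mulmx_edge (G : 'M[R]_2) P Q S :
  G *m edge_mx P Q S = edge_mx (G *m P) (G *m Q) (G *m S).
Proof. by rewrite /edge_mx -!mulmxBr; exact: (@mul_mx_row _ _ _ 1 1). Qed.

Lemma grad_affine u P Q S (G : 'M[R]_2) : edge_mx P Q S \in unitmx ->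
  G = grad u (Triangle P Q S) <->
  exists b, [/\ u P = G *m P + b, u Q = G *m Q + b & u S = G *m S + b].
Proof.
move=> T_unit; rewrite /grad /=; split.
  move=> /(congr1 (fun M => M *m edge_mx P Q S)); rewrite mulmxKV //.
  rewrite mulmx_edge => /(@eq_row_mx _ 2 1 1) [eQ eS].
  exists (u P - G *m P); split; first by rewrite addrC subrK.
    by rewrite addrC -addrA [- _ + _]addrC eQ addrC subrK.
  by rewrite addrC -addrA [- _ + _]addrC eS addrC subrK.
move=> [b [uP uQ uS]]; rewrite -[LHS](mulmxK T_unit); congr (_ *m _).
have bK (x y b0 : 'cV[R]_2) : x + b0 - (y + b0) = x - y.
  by rewrite opprD addrACA subrr addr0.
by rewrite mulmx_edge uP uQ uS /edge_mx !bK.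
Qed.

Definition SO2 (Q : 'M[R]_2) : Prop := Q *m Q^T = 1%:M /\ \det Q = 1.

End Plane.

Record metamaterial (R : realType) := Metamaterial {
  lat1 : 'cV[R]_2;
  lat2 : 'cV[R]_2;
  basic_nodes : seq 'cV[R]_2;
  springs : seq (spring R);
  penalized : seq (triangle R) }.

Definition kagome (R : realType) : metamaterial R :=
  let s := Num.sqrt 3 : R in
  let O := pt 0 0 in
  let A := pt (1 / 2) (s / 2) in
  let B := pt (- (1 / 2)) (s / 2) in
  let C := pt (- (1 / 2)) (- (s / 2)) in
  let D := pt (1 / 2) (- (s / 2)) in
  let E := pt (3 / 2) (- (s / 2)) in
  let F := pt (3 / 2) (s / 2) in
  {| lat1 := pt 2 0;
     lat2 := pt 1 s;
     basic_nodes := [:: A; O; D];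
     springs := [:: Spring 1 A O; Spring 1 B O; Spring 1 C O;
                    Spring 1 D O; Spring 1 A F; Spring 1 D E];
     penalized := [:: Triangle A O B; Triangle C O D] |}.

Definition rotating_squares (R : realType) : metamaterial R :=
  let A := pt (-1) 1 in
  let B := pt 0 1 in
  let C := pt 1 1 in
  let D := pt (-1) 0 in
  let O := pt 0 0 in
  let E := pt 1 0 in
  let F := pt (-1) (-1) in
  let G := pt 0 (-1) in
  let H := pt 1 (-1) in
  {| lat1 := pt 2 0;
     lat2 := pt 0 2;
     basic_nodes := [:: O; A; B; D];
     springs := [:: Spring 1 A B; Spring 2 A O; Spring 1 A D; Spring 1 B C;
                    Spring 1 B O; Spring 1 D O; Spring 1 E O; Spring 1 D F;
                    Spring 1 O G; Spring 2 O H];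
     penalized := [:: Triangle A O B; Triangle A O D;
                      Triangle E O H; Triangle G O H] |}.

Section Mechanism.
Variables (R : realType) (M : metamaterial R).

(* Deformations are represented by total functions on the plane, of which only
   the values on [nodes M] are ever used: all endpoints of springs, all
   vertices of penalized triangles and their lattice translates are nodes. *)
Implicit Types (u psi : 'cV[R]_2 -> 'cV[R]_2).

Definition lattice_vec (a1 a2 : int) : 'cV[R]_2 :=
  lat1 M *~ a1 + lat2 M *~ a2.

Definition nodes : set 'cV[R]_2 :=
  [set x | exists p a1 a2, p \in basic_nodes M /\ x = p + lattice_vec a1 a2].

Definition spring_energy u : R :=
  \sum_(s <- springs M) stiffness s *
    (enorm (u (spring_src s) - u (spring_tgt s))
     - enorm (spring_src s - spring_tgt s)) ^+ 2.

Definition penalty (eta t : R) : R := if t <= 0 then eta^-1 else 0.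

(* [energy eta u] is E^eta(u, U) for the reference cell U, which enters the
   energy only through the lists [springs M] and [penalized M]. *)
Definition energy (eta : R) u : R :=
  spring_energy u +
  \sum_(T <- penalized M) area T * penalty eta (\det (grad u T)).

Definition cell_energy (eta : R) u (a1 a2 : int) : R :=
  energy eta (fun x => u (x + lattice_vec a1 a2)).

Definition periodic (k : nat) psi : Prop :=
  forall x, nodes x ->
    psi (x + lat1 M *+ k) = psi x /\ psi (x + lat2 M *+ k) = psi x.

Definition periodic_mechanism (eta : R) (k : nat) (lambda : 'M[R]_2) psi u :
    Prop :=
  [/\ forall x, nodes x -> u x = lambda *m x + psi x,
      periodic k psi
    & forall a1 a2 : int, cell_energy eta u a1 a2 = 0].

End Mechanism.

Definition isotropic_compression (R : realType) (lambda : 'M[R]_2) : Prop :=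
  exists c Q, [/\ 0 <= c, c <= 1, SO2 Q & lambda = c *: Q].

(* Main.v *)
Require Import Defs.
From mathcomp Require Import all_boot all_order all_algebra.
From mathcomp Require Import boolp classical_sets reals.
From mathcomp Require Import ring lra.

Set Implicit Arguments.
Unset Strict Implicit.
Unset Printing Implicit Defensive.

Import Order.TTheory GRing.Theory Num.Theory.
Local Open Scope ring_scope.

(** In both metamaterials the node [O] is a hinge between two rigid triangles,
    [(O, X, Y)] and its point reflection [(O, -X, -Y)], such that [2 X] and
    [2 Y] are lattice vectors: [AOB] and [COD] for Kagome, [AOD] and [EOH] for
    Rotating Squares. Zero energy means that no spring is stretched and no
    penalized triangle is folded over, so in every cell the two triangles are
    rotated, by [P] and [Q] say ([rigid_grad_SO2], [rotated_penalized]).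

    Crossing the hinge from [-X] to [X] gives [u X - u (-X) = (P + Q) X].
    Since [X] and [-X] differ by a lattice vector, the left-hand side is
    [2 lambda X] plus the increment of [psi] along that vector, and these
    increments add up to zero over the [k * k] cells of a period
    ([cell_sum_shift]). The same holds for [Y], and [X], [Y] form a basis, so
    [lambda] is the mean over a period of the matrices [(P + Q) / 2]
    ([hinge_isotropic_compression]).

    Under the identification of [[a, -b], [b, a]] with [a + b i], rotations are
    the complex numbers of modulus one and isotropic compressions those of
    modulus at most one. The unit disc is convex, so a mean of rotations is an
    isotropic compression ([isotropic_compression_mean]). *)

(** * Isotropic compressions *)

Section Compressions.
Variable R : realType.
Implicit Types (L Q : 'M[R]_2).

Lemma mx2P L Q :
  L 0 0 = Q 0 0 -> L 0 1 = Q 0 1 -> L 1 0 = Q 1 0 -> L 1 1 = Q 1 1 -> L = Q.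
Proof.
move=> h00 h01 h10 h11; apply/matrixP => i j.
have I2 (x : 'I_2) : x = 0 \/ x = 1.
  by case: x => [[|[|//]] lt_x]; [left | right]; apply: val_inj.
by case: (I2 i) (I2 j) => [->|->] [->|->].
Qed.

Lemma det2E L : \det L = L 0 0 * L 1 1 - L 0 1 * L 1 0.
Proof.
rewrite (expand_det_row _ 0) !big_ord_recl big_ord0 /cofactor !det_mx11 !mxE.
rewrite /= addr0 expr0 mul1r expr1 mulN1r mulrN.
by congr (_ * L _ _ - L _ _ * L _ _); apply: val_inj.
Qed.

Lemma SO2E L :
  SO2 L <-> [/\ L 1 1 = L 0 0, L 0 1 = - L 1 0 & L 0 0 ^+ 2 + L 1 0 ^+ 2 = 1].
Proof.
have mulE i j : (L *m L^T) i j = L i 0 * L j 0 + L i 1 * L j 1.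
  rewrite !mxE !big_ord_recl big_ord0 !mxE addr0.
  by congr (_ + L _ _ * L _ _); apply: val_inj.
split=> [[LLT detL]|[h11 h01 h1]].
  have e00 := mulE 0 0; have e11 := mulE 1 1.
  move: e00 e11 detL; rewrite LLT !mxE /= det2E => e00 e11 detL.
  have sq0 : (L 0 0 - L 1 1) ^+ 2 + (L 0 1 + L 1 0) ^+ 2 = 0 by lra.
  move/eqP: sq0; rewrite paddr_eq0 ?sqr_ge0 // !sqrf_eq0.
  by move=> /andP[/eqP d0 /eqP d1]; split; nra.
split; last by rewrite det2E h11 h01; lra.
by apply: mx2P; rewrite mulE !mxE /= ?h11 ?h01; lra.
Qed.

(** The matrices [[a, -b], [b, a]] act as the complex numbers [a + b i]; the
    polar form of such a number of modulus at most one is a compression factor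
    together with a rotation. *)
Lemma isotropic_compressionE L :
  isotropic_compression L <->
  [/\ L 1 1 = L 0 0, L 0 1 = - L 1 0 & L 0 0 ^+ 2 + L 1 0 ^+ 2 <= 1].
Proof.
split=> [[c [Q [c0 c1 /SO2E[h11 h01 h1] ->]]]|[h11 h01 h1]].
  rewrite !mxE h11 h01 mulrN; split=> //.
  by rewrite !exprMn -mulrDr h1 mulr1 expr_le1.
set r2 := L 0 0 ^+ 2 + L 1 0 ^+ 2 in h1.
have r2_ge0 : 0 <= r2 by rewrite addr_ge0 ?sqr_ge0.
have r_le1 : Num.sqrt r2 <= 1 by rewrite -sqrtr1 ler_sqrt.
have [r0|r_neq0] := eqVneq (Num.sqrt r2) 0.
  (* No direction can be read off the zero matrix: any rotation will do. *)
  exists 0, 1%:M; split; rewrite ?ler01 //.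
    by apply/SO2E; rewrite !mxE /=; split; lra.
  move: r0 => /eqP; rewrite sqrtr_eq0 => r2_le0.
  have : r2 == 0 by rewrite eq_le r2_le0.
  rewrite paddr_eq0 ?sqr_ge0 // !sqrf_eq0 => /andP[/eqP L00 /eqP L10].
  by apply: mx2P; rewrite !mxE ?h11 ?h01 ?L00 ?L10; lra.
exists (Num.sqrt r2), ((Num.sqrt r2)^-1 *: L); split=> //.
- exact: sqrtr_ge0.
- apply/SO2E; rewrite !mxE h11 h01 mulrN; split=> //.
  rewrite !exprMn -mulrDr -/r2 -[X in _ * X](sqr_sqrtr r2_ge0) exprVn mulVf //.
  by rewrite sqrf_eq0.
- by rewrite scalerA mulfV // scale1r.
Qed.

Lemma SO2_isotropic Q : SO2 Q -> isotropic_compression Q.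
Proof. by move=> rotQ; exists 1, Q; rewrite scale1r. Qed.

(** By convexity of the unit disc: if [w] is the mean of the [w_i],
    then [|w|^2] is the mean of the scalar products [<w, w_i>], each of which is
    at most [(|w|^2 + 1) / 2], whence [|w|^2 <= 1]. *)
Lemma isotropic_compression_mean (I : finType) (W : I -> 'M[R]_2) L :
    (0 < #|I|)%N -> (forall i, isotropic_compression (W i)) ->
    \sum_i W i = L *+ #|I| ->
  isotropic_compression L.
Proof.
move=> I_gt0 compW sumW.
have entry i j : \sum_s W s i j = #|I|%:R * L i j.
  by rewrite -summxE sumW mulmxnE mulr_natl.
have n_gt0 : 0 < #|I|%:R :> R by rewrite ltr0n.
have n_neq0 : #|I|%:R != 0 :> R by rewrite gt_eqF.
apply/isotropic_compressionE; split.
- apply: (mulfI n_neq0); rewrite -!entry; apply: eq_bigr => s _.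
  by have /isotropic_compressionE[] := compW s.
- apply: (mulfI n_neq0); rewrite mulrN -!entry -sumrN; apply: eq_bigr => s _.
  by have /isotropic_compressionE[] := compW s.
set a := L 0 0; set b := L 1 0; set q := a ^+ 2 + b ^+ 2.
have dotE : \sum_s (a * W s 0 0 + b * W s 1 0) = #|I|%:R * q.
  by rewrite big_split /= -!mulr_sumr !entry -/a -/b /q; ring.
have dot_le : \sum_s (a * W s 0 0 + b * W s 1 0) <= \sum_(s : I) ((q + 1) / 2).
  apply: ler_sum => s _; have /isotropic_compressionE[_ _ w_le1] := compW s.
  have := sqr_ge0 (a - W s 0 0); have := sqr_ge0 (b - W s 1 0).
  by rewrite /q; lra.
move: dot_le; rewrite dotE sumr_const -[leRHS]mulr_natl ler_pM2l //.
by lra.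
Qed.

End Compressions.

(** * Rigid triangles *)

Section Triangles.
Variable R : realType.
Implicit Types (u : 'cV[R]_2 -> 'cV[R]_2) (T : triangle R) (x y : 'cV[R]_2).

Definition reference_mx T : 'M[R]_2 :=
  edge_mx (vertex0 T) (vertex1 T) (vertex2 T).

Definition corners T : seq 'cV[R]_2 := [:: vertex0 T; vertex1 T; vertex2 T].

Lemma det_edge_mx (x y z : 'cV[R]_2) :
  \det (edge_mx x y z) =
  (y 0 0 - x 0 0) * (z 1 0 - x 1 0) - (z 0 0 - x 0 0) * (y 1 0 - x 1 0).
Proof.
have lE (v w : 'cV[R]_2) i : (row_mx v w : 'M_(2, 1 + 1)) i 0 = v i 0.
  by rewrite mxE; case: splitP => // j _; rewrite ord1.
have rE (v w : 'cV[R]_2) i : (row_mx v w : 'M_(2, 1 + 1)) i 1 = w i 0.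
  by rewrite mxE; case: splitP => j; rewrite ord1.
by rewrite det2E /edge_mx !lE !rE !mxE.
Qed.

Lemma grad_corners u T x y : reference_mx T \in unitmx ->
  x \in corners T -> y \in corners T -> grad u T *m (x - y) = u x - u y.
Proof.
case: T => p q s; rewrite /corners /= => T_unit.
have [b [up uq us]] := (grad_affine u (grad u (Triangle p q s)) T_unit).1 erefl.
have affine z : z \in [:: p; q; s] -> u z = grad u (Triangle p q s) *m z + b.
  by rewrite !inE => /or3P[] /eqP->.
move=> /affine -> /affine ->.
by rewrite opprD addrACA subrr addr0 mulmxBr.
Qed.

Lemma enorm_gram x : x^T *m x = (enorm x ^+ 2)%:M.
Proof.
rewrite [LHS]mx11_scalar; congr (_%:M); rewrite mxE sqr_sqrtr.
  by apply: eq_bigr => i _; rewrite mxE.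
by apply: sumr_ge0 => i _; rewrite sqr_ge0.
Qed.

Lemma enormN x : enorm (- x) = enorm x.
Proof.
by rewrite /enorm; congr (Num.sqrt _); apply: eq_bigr => i _; rewrite mxE sqrrN.
Qed.

Lemma gram_polarization (x y : 'cV[R]_2) :
  (x^T *m y) *+ 2 = (enorm x ^+ 2 + enorm y ^+ 2 - enorm (x - y) ^+ 2)%:M.
Proof.
have sym : y^T *m x = x^T *m y.
  apply/matrixP => i j; rewrite !mxE; apply: eq_bigr => l _.
  by rewrite !mxE !ord1 mulrC.
have trB : (x - y)^T = x^T - y^T by apply/matrixP => i j; rewrite !mxE.
rewrite raddfB raddfD /= -!enorm_gram trB mulmxBl !mulmxBr sym.
by apply/matrixP => i j; rewrite !mxE; ring.
Qed.

(** Side lengths determine the Gram matrix of the edge vectors by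
    polarisation, so the gradient [G] satisfies [G^T G = 1]; the positive
    determinant then excludes reflections. *)
Lemma rigid_grad_SO2 u T :
    reference_mx T \in unitmx ->
    (forall x y, x \in corners T -> y \in corners T ->
       enorm (u x - u y) = enorm (x - y)) ->
    0 < \det (grad u T) ->
  SO2 (grad u T).
Proof.
move=> T_unit iso det_gt0; set G := grad u T in det_gt0 *.
set E := reference_mx T in T_unit.
have gramE : (G *m E)^T *m (G *m E) = E^T *m E.
  pose e1 := vertex1 T - vertex0 T; pose e2 := vertex2 T - vertex0 T.
  have isoG x y : x \in corners T -> y \in corners T ->
      enorm (G *m (x - y)) = enorm (x - y).
    by move=> xT yT; rewrite grad_corners // iso.
  have v0 : vertex0 T \in corners T by rewrite !inE eqxx.
  have v1 : vertex1 T \in corners T by rewrite !inE eqxx orbT.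
  have v2 : vertex2 T \in corners T by rewrite !inE eqxx !orbT.
  have n1 : enorm (G *m e1) = enorm e1 by exact: isoG.
  have n2 : enorm (G *m e2) = enorm e2 by exact: isoG.
  have e21 : e2 - e1 = vertex2 T - vertex1 T.
    by rewrite /e1 /e2 opprB addrA subrK.
  have n21 : enorm (G *m e2 - G *m e1) = enorm (e2 - e1).
    by rewrite -mulmxBr e21; exact: isoG.
  have n12 : enorm (G *m e1 - G *m e2) = enorm (e1 - e2).
    by rewrite -enormN opprB n21 -enormN opprB.
  have half (A B : 'M[R]_1) : A *+ 2 = B *+ 2 -> A = B.
    move=> AB; apply/matrixP => i j; move/matrixP/(_ i j): AB.
    by rewrite !mxE; lra.
  have g12 : (G *m e1)^T *m (G *m e2) = e1^T *m e2.
    by apply: half; rewrite !gram_polarization n1 n2 n12.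
  have g21 : (G *m e2)^T *m (G *m e1) = e2^T *m e1.
    by apply: half; rewrite !gram_polarization n1 n2 n21.
  have -> : E = row_mx e1 e2 :> 'M[R]_(2, 1 + 1) by [].
  rewrite (@mul_mx_row _ _ _ 1 1) !(@tr_row_mx _ _ 1 1).
  rewrite !(@mul_col_row _ 1 1 _ 1 1).
  by rewrite g12 g21 !enorm_gram n1 n2.
clearbody G E.
have GTG : G^T *m G = 1%:M.
  apply: (can_inj (mulKmx (_ : E^T \in unitmx))); first by rewrite unitmx_tr.
  apply: (can_inj (mulmxK T_unit)).
  by rewrite mulmx1 !mulmxA -[RHS]gramE trmx_mul !mulmxA.
split; first exact: mulmx1C.
have := congr1 determinant GTG; rewrite det_mulmx det_tr det1 => det_sq.
nra.
Qed.

End Triangles.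

(** * Sums over a period *)

Section PeriodSums.
Variable V : zmodType.

(** One step of the shift replaces the first term of the sum by the next term
    after the last, which periodicity makes equal to it. *)
Lemma period_sum_shift (k : nat) (f : int -> V) (b : int) :
    (forall a, f (a + k%:Z) = f a) ->
  \sum_(i < k) f (i%:Z + b) = \sum_(i < k) f i%:Z.
Proof.
have shift1 (g : int -> V) : (forall a, g (a + k%:Z) = g a) ->
    \sum_(i < k) g (i%:Z + 1) = \sum_(i < k) g i%:Z.
  move=> gk; apply: (addrI (g 0)); rewrite [RHS]addrC.
  have -> : g 0 = g k%:Z by rewrite -[in RHS](add0r k%:Z) gk.
  rewrite -(big_ord_recr k (fun i => g i%:Z)) /= big_ord_recl /=.
  rewrite -[in LHS](add0r k%:Z) gk; congr (_ + _).
  by apply: eq_bigr => i _; congr g; rewrite /bump /= intS addrC.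
have shiftn (n : nat) (g : int -> V) : (forall a, g (a + k%:Z) = g a) ->
    \sum_(i < k) g (i%:Z + n%:Z) = \sum_(i < k) g i%:Z.
  elim: n g => [|n IHn] g gk; first by apply: eq_bigr => i _; rewrite addr0.
  rewrite -(shift1 g gk) -(IHn (fun a => g (a + 1))) => [|a].
    by apply: eq_bigr => i _; rewrite -addrA intS [1 + _]addrC.
  by rewrite addrAC gk.
move=> fk; case: (intP b) => [|n|n]; [exact: (shiftn 0%N) | exact: shiftn | ].
rewrite -(shiftn n.+1 (fun a => f (a - n.+1%:Z))) => [|a].
  by apply: eq_bigr => i _; rewrite addrK.
by rewrite addrAC fk.
Qed.

Lemma cell_sum_shift (k : nat) (f : int -> int -> V) (b1 b2 : int) :
    (forall a1 a2, f (a1 + k%:Z) a2 = f a1 a2) ->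
    (forall a1 a2, f a1 (a2 + k%:Z) = f a1 a2) ->
  \sum_(a : 'I_k * 'I_k) f (a.1%:Z + b1) (a.2%:Z + b2) =
  \sum_(a : 'I_k * 'I_k) f a.1%:Z a.2%:Z.
Proof.
move=> f1 f2.
rewrite -(pair_bigA _ (fun i j : 'I_k => f (i%:Z + b1) (j%:Z + b2))) /=.
rewrite -(pair_bigA _ (fun i j : 'I_k => f i%:Z j%:Z)) /=.
rewrite (period_sum_shift (f := fun a => \sum_(j < k) f a (j%:Z + b2))) => [|a].
  by apply: eq_bigr => i _; apply: period_sum_shift => a; exact: f2.
by apply: eq_bigr => j _; exact: f1.
Qed.

End PeriodSums.

(** * Zero-energy deformations *)

Lemma sum_all_ge0_eq0 (R : numDomainType) (I : Type) (r : seq I) (P : pred I)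
    (F : I -> R) :
    all P r -> (forall i, P i -> 0 <= F i) ->
  0 <= \sum_(i <- r) F i /\
  (\sum_(i <- r) F i = 0 -> all (fun i => F i == 0) r).
Proof.
move=> + F_ge0; elim: r => [|i r IHr] /=; first by rewrite big_nil.
move=> /andP[/F_ge0 Fi_ge0 /IHr[r_ge0 r0]]; rewrite big_cons addr_ge0 //.
by split=> // /eqP; rewrite paddr_eq0 // => /andP[-> /eqP/r0].
Qed.

Section Mechanisms.
Variables (R : realType) (M : metamaterial R) (eta : R) (eta_gt0 : 0 < eta).
Variables (k : nat) (k_gt0 : (0 < k)%N).
Variables (lambda : 'M[R]_2) (psi u : 'cV[R]_2 -> 'cV[R]_2).
Hypothesis mech : periodic_mechanism M eta k lambda psi u.

Implicit Types (x y : 'cV[R]_2) (T : triangle R).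

Local Notation vec := (lattice_vec M).

Lemma translateD x a1 a2 b1 b2 :
  x + vec a1 a2 + vec b1 b2 = x + vec (a1 + b1) (a2 + b2).
Proof.
by rewrite -addrA /lattice_vec !mulrzDr; congr (_ + _); rewrite addrACA.
Qed.

Lemma nodes_translate x a1 a2 : nodes M x -> nodes M (x + vec a1 a2).
Proof.
move=> [p [b1 [b2 [pV ->]]]]; exists p, (b1 + a1), (b2 + a2); split=> //.
exact: translateD.
Qed.

Definition unstretched x y : Prop :=
  forall a1 a2, enorm (u (x + vec a1 a2) - u (y + vec a1 a2)) = enorm (x - y).

Definition rotated T : Prop :=
  forall a1 a2, SO2 (grad (fun x => u (x + vec a1 a2)) T).

Lemma unstretched_sym x y : unstretched x y -> unstretched y x.
Proof. by move=> xy a1 a2; rewrite -enormN opprB xy -enormN opprB. Qed.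

Lemma unstretched_translate x y b1 b2 :
  unstretched x y -> unstretched (x + vec b1 b2) (y + vec b1 b2).
Proof.
move=> xy a1 a2; rewrite !translateD xy.
by rewrite opprD addrACA subrr addr0.
Qed.

(** Every term of the energy is nonnegative, so each of them vanishes; for a
    nondegenerate penalized triangle the weight [area T / eta] is nonzero, which
    forces the determinant of the gradient to be positive. *)
Lemma zero_energy_terms a1 a2 :
    all (fun s => 0 < stiffness s) (springs M) ->
  let v x := u (x + vec a1 a2) in
  all (fun s => enorm (v (spring_src s) - v (spring_tgt s)) ==
                enorm (spring_src s - spring_tgt s)) (springs M) /\
  all (fun T => (reference_mx T \in unitmx) ==> (0 < \det (grad v T)))
    (penalized M).
Proof.
move=> stiff v; have [_ _ /(_ a1 a2)] := mech.
rewrite /cell_energy -/v /energy /spring_energy => /eqP.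
have pen_ge0 T : true -> 0 <= area T * penalty eta (\det (grad v T)).
  move=> _; apply: mulr_ge0; first by rewrite divr_ge0.
  by rewrite /penalty; case: ifP => // _; rewrite invr_ge0 ltW.
have spring_ge0 s : 0 < stiffness s -> 0 <= stiffness s *
    (enorm (v (spring_src s) - v (spring_tgt s))
     - enorm (spring_src s - spring_tgt s)) ^+ 2.
  by move=> s_gt0; rewrite mulr_ge0 ?sqr_ge0 // ltW.
have [spr_ge0 spr0] := sum_all_ge0_eq0 stiff spring_ge0.
have [tri_ge0 tri0] := sum_all_ge0_eq0 (all_predT (penalized M)) pen_ge0.
rewrite paddr_eq0 // => /andP[/eqP/spr0 {}spr0 /eqP/tri0 {}tri0]; split.
  have := conj stiff spr0 => /andP; rewrite -all_predI.
  apply: sub_all => s /= /andP[s_gt0].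
  by rewrite mulf_eq0 gt_eqF //= sqrf_eq0 subr_eq0.
apply: sub_all tri0 => T /=; rewrite unitmxE unitfE => tri0.
apply/implyP => T_unit; rewrite ltNge; apply/negP => det_le0.
move: tri0; rewrite /penalty det_le0 mulf_eq0 invr_eq0 (gt_eqF eta_gt0) orbF.
by rewrite mulf_eq0 normr_eq0 (negPf T_unit) invr_eq0 pnatr_eq0.
Qed.

Lemma unstretched_spring i :
    all (fun s => 0 < stiffness s) (springs M) -> (i < size (springs M))%N ->
  let s := nth (Spring 0 0 0) (springs M) i in
  unstretched (spring_src s) (spring_tgt s).
Proof.
move=> stiff lt_i s a1 a2; have [taut _] := zero_energy_terms a1 a2 stiff.
by apply/eqP; exact: (all_nthP _ taut).
Qed.

Lemma rotated_penalized i :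
    all (fun s => 0 < stiffness s) (springs M) -> (i < size (penalized M))%N ->
  let T := nth (Triangle 0 0 0) (penalized M) i in
    reference_mx T \in unitmx ->
    unstretched (vertex0 T) (vertex1 T) ->
    unstretched (vertex1 T) (vertex2 T) ->
    unstretched (vertex2 T) (vertex0 T) ->
  rotated T.
Proof.
move=> stiff lt_i T T_unit l01 l12 l20 a1 a2.
have l10 := unstretched_sym l01; have l21 := unstretched_sym l12.
have l02 := unstretched_sym l20.
apply: rigid_grad_SO2 => // [x y|].
  by rewrite !inE => /or3P[] /eqP-> /or3P[] /eqP->; rewrite ?subrr.
have [_ oriented] := zero_energy_terms a1 a2 stiff.
exact: (implyP (all_nthP (Triangle 0 0 0) oriented i lt_i)).
Qed.

(** The image of the origin is common to both triangles. Hence, with [u] read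
    relative to a given cell, their rotations [P] and [Q] in that cell satisfy
    [(P + Q) X = u X - u (- X)]. As [X] is the translate of [- X] by a lattice
    vector, the right-hand side is [2 lambda X] plus a difference of values of
    [psi] that cancels out in the sum over a period. The same holds for [Y], so
    [lambda] is the mean of the [(P + Q) / 2]. *)
Lemma hinge_isotropic_compression (T1 T2 : triangle R) (X Y : 'cV[R]_2) :
    reference_mx T1 \in unitmx -> reference_mx T2 \in unitmx ->
    rotated T1 -> rotated T2 ->
    0 \in corners T1 -> X \in corners T1 -> Y \in corners T1 ->
    0 \in corners T2 -> - X \in corners T2 -> - Y \in corners T2 ->
    edge_mx 0 X Y \in unitmx ->
    nodes M (- X) -> nodes M (- Y) ->
    (exists b1 b2, X *+ 2 = vec b1 b2) -> (exists b1 b2, Y *+ 2 = vec b1 b2) ->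
  isotropic_compression lambda.
Proof.
move=> T1_unit T2_unit rot1 rot2 O1 X1 Y1 O2 X2 Y2 XY_unit nX nY latX latY.
pose at_cell (a : 'I_k * 'I_k) := fun x => u (x + vec a.1%:Z a.2%:Z).
pose W a := 2^-1 *: (grad (at_cell a) T1 + grad (at_cell a) T2).
apply: (@isotropic_compression_mean _ ('I_k * 'I_k)%type W).
- by rewrite card_prod card_ord muln_gt0 k_gt0.
- move=> a; apply: (@isotropic_compression_mean _ bool
    (fun b => grad (at_cell a) (if b then T1 else T2))).
  + by rewrite card_bool.
  + by case; apply: SO2_isotropic; [exact: rot1 | exact: rot2].
  + by rewrite big_bool card_bool -scaler_nat scalerA divff ?scale1r ?pnatr_eq0.
have [u_eq psi_per _] := mech.
have sumW Z : Z \in corners T1 -> - Z \in corners T2 -> nodes M (- Z) ->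
    (exists b1 b2, Z *+ 2 = vec b1 b2) ->
    (\sum_a W a) *m Z = (lambda *+ #|{: 'I_k * 'I_k}|) *m Z.
  move=> Z1 Z2 nZ [b1 [b2 latZ]].
  have Z_eq : Z = - Z + vec b1 b2 by rewrite -latZ mulr2n addKr.
  pose f (a1 a2 : int) := psi (- Z + vec a1 a2).
  have disp (a : 'I_k * 'I_k) : W a *m Z =
      lambda *m Z + 2^-1 *: (f (a.1%:Z + b1) (a.2%:Z + b2) - f a.1%:Z a.2%:Z).
    have g1 : grad (at_cell a) T1 *m Z = at_cell a Z - at_cell a 0.
      by rewrite -(grad_corners (at_cell a) T1_unit Z1 O1) subr0.
    have g2 : grad (at_cell a) T2 *m Z = at_cell a 0 - at_cell a (- Z).
      by rewrite -(grad_corners (at_cell a) T2_unit O2 Z2) opprK add0r.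
    rewrite /W -scalemxAl mulmxDl g1 g2 addrA subrK /at_cell.
    have Za_eq : Z + vec a.1 a.2 = - Z + vec (a.1%:Z + b1) (a.2%:Z + b2).
      by rewrite {1}Z_eq translateD [b1 + _]addrC [b2 + _]addrC.
    have -> : u (Z + vec a.1 a.2) =
        lambda *m (Z + vec a.1 a.2) + f (a.1%:Z + b1) (a.2%:Z + b2).
      by rewrite Za_eq u_eq //; exact: nodes_translate.
    rewrite u_eq; last exact: nodes_translate.
    rewrite -/(f _ _) !mulmxDr mulmxN.
    by apply/colP => i; rewrite !mxE; lra.
  rewrite mulmx_suml (eq_bigr _ (fun a _ => disp a)) big_split /= sumr_const.
  rewrite -scaler_sumr sumrB cell_sum_shift.
  - by rewrite subrr scaler0 addr0 -[in RHS]sumr_const mulmx_suml sumr_const.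
  - move=> a1 a2; rewrite /f -[a2 in LHS]addr0 -translateD.
    rewrite [vec k%:Z 0]/lattice_vec mulr0z addr0.
    by have [-> _] := psi_per _ (nodes_translate a1 a2 nZ).
  move=> a1 a2; rewrite /f -[a1 in LHS]addr0 -translateD.
  rewrite [vec 0 k%:Z]/lattice_vec mulr0z add0r.
  by have [_ ->] := psi_per _ (nodes_translate a1 a2 nZ).
apply: (can_inj (mulmxK XY_unit)).
by rewrite !mulmx_edge !mulmx0 !sumW.
Qed.

End Mechanisms.

(** * Kagome and Rotating Squares *)

Lemma edge_mx_unit (R : realType) (x y z : 'cV[R]_2) :
  (y 0 0 - x 0 0) * (z 1 0 - x 1 0) - (z 0 0 - x 0 0) * (y 1 0 - x 1 0) != 0 ->
  edge_mx x y z \in unitmx.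
Proof. by rewrite unitmxE unitfE det_edge_mx. Qed.

Ltac by_coordinates :=
  apply/colP; case=> [[|[|//]] ?]; rewrite /lattice_vec !mxE /=; lra.

Ltac unit_by_coordinates :=
  apply: edge_mx_unit; rewrite neq_lt !mxE /=; apply/orP;
  first [left; lra | right; lra].

Lemma kagome_isotropic_compression (R : realType) (eta : R) (eta_gt0 : 0 < eta)
    (k : nat) (k_gt0 : (0 < k)%N) (lambda : 'M[R]_2) psi u :
  periodic_mechanism (kagome R) eta k lambda psi u ->
  isotropic_compression lambda.
Proof.
move=> mech.
have stiff : all (fun s => 0 < stiffness s) (springs (kagome R)).
  by rewrite /= ltr01.
have s_gt0 : 0 < Num.sqrt 3 :> R by rewrite sqrtr_gt0.
pose A : 'cV[R]_2 := pt (1 / 2) (Num.sqrt 3 / 2).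
pose B : 'cV[R]_2 := pt (- (1 / 2)) (Num.sqrt 3 / 2).
pose C : 'cV[R]_2 := pt (- (1 / 2)) (- (Num.sqrt 3 / 2)).
pose D : 'cV[R]_2 := pt (1 / 2) (- (Num.sqrt 3 / 2)).
pose O : 'cV[R]_2 := pt 0 0.
have spring i := @unstretched_spring _ _ _ eta_gt0 _ _ _ _ mech i stiff.
have AO := spring 0%N erefl; have BO := spring 1%N erefl.
have CO := spring 2%N erefl; have DO := spring 3%N erefl.
(* The sides [AB] and [CD] of the two triangles are lattice translates of the
   springs [DE] and [AF]. *)
have BA : unstretched (kagome R) u B A.
  have := unstretched_translate (-1) 1 (spring 5%N erefl).
  congr unstretched; by_coordinates.
have DC : unstretched (kagome R) u D C.
  have := unstretched_translate 0 (-1) (unstretched_sym (spring 4%N erefl)).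
  congr unstretched; by_coordinates.
have AOB_unit : reference_mx (Triangle A O B) \in unitmx.
  unit_by_coordinates.
have COD_unit : reference_mx (Triangle C O D) \in unitmx.
  unit_by_coordinates.
have AOB_rot : rotated (kagome R) u (Triangle A O B).
  exact: (@rotated_penalized _ _ _ eta_gt0 _ _ _ _ mech 0%N stiff erefl AOB_unit
    AO (unstretched_sym BO) BA).
have COD_rot : rotated (kagome R) u (Triangle C O D).
  exact: (@rotated_penalized _ _ _ eta_gt0 _ _ _ _ mech 1%N stiff erefl COD_unit
    CO (unstretched_sym DO) DC).
have O0 : O = 0 by by_coordinates.
have NA : - A = C by by_coordinates.
have NB : - B = D by by_coordinates.
apply: (hinge_isotropic_compression k_gt0 mech (X := A) (Y := B)
  AOB_unit COD_unit AOB_rot COD_rot);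
  rewrite ?NA ?NB -?O0 /corners /= ?inE ?eqxx ?orbT //.
- unit_by_coordinates.
- exists A, 0, (-1); rewrite !inE eqxx; split=> //; by_coordinates.
- exists D, 0, 0; rewrite !inE eqxx !orbT; split=> //; by_coordinates.
- exists 0, 1; by_coordinates.
- exists (-1), 1; by_coordinates.
Qed.

Lemma rotating_squares_isotropic_compression (R : realType) (eta : R)
    (eta_gt0 : 0 < eta) (k : nat) (k_gt0 : (0 < k)%N) (lambda : 'M[R]_2) psi u :
  periodic_mechanism (rotating_squares R) eta k lambda psi u ->
  isotropic_compression lambda.
Proof.
move=> mech.
have stiff : all (fun s => 0 < stiffness s) (springs (rotating_squares R)).
  by rewrite /= ltr01 ltr0n.
pose A : 'cV[R]_2 := pt (-1) 1; pose D : 'cV[R]_2 := pt (-1) 0.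
pose O : 'cV[R]_2 := pt 0 0; pose E : 'cV[R]_2 := pt 1 0.
pose H : 'cV[R]_2 := pt 1 (-1).
have spring i := @unstretched_spring _ _ _ eta_gt0 _ _ _ _ mech i stiff.
have AO := spring 1%N erefl; have AD := spring 2%N erefl.
have DO := spring 5%N erefl; have EO := spring 6%N erefl.
have OH := spring 9%N erefl.
(* The side [EH] is the translate of the spring [DF] by the first lattice
   vector. *)
have EH : unstretched (rotating_squares R) u E H.
  have := unstretched_translate 1 0 (spring 7%N erefl).
  congr unstretched; by_coordinates.
have AOD_unit : reference_mx (Triangle A O D) \in unitmx.
  unit_by_coordinates.
have EOH_unit : reference_mx (Triangle E O H) \in unitmx.
  unit_by_coordinates.
have AOD_rot : rotated (rotating_squares R) u (Triangle A O D).
  exact: (@rotated_penalized _ _ _ eta_gt0 _ _ _ _ mech 1%N stiff erefl AOD_unit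
    AO (unstretched_sym DO) (unstretched_sym AD)).
have EOH_rot : rotated (rotating_squares R) u (Triangle E O H).
  exact: (@rotated_penalized _ _ _ eta_gt0 _ _ _ _ mech 2%N stiff erefl EOH_unit
    EO OH (unstretched_sym EH)).
have O0 : O = 0 by by_coordinates.
have NA : - A = H by by_coordinates.
have ND : - D = E by by_coordinates.
apply: (hinge_isotropic_compression k_gt0 mech (X := A) (Y := D)
  AOD_unit EOH_unit AOD_rot EOH_rot);
  rewrite ?NA ?ND -?O0 /corners /= ?inE ?eqxx ?orbT //.
- unit_by_coordinates.
- exists A, 1, (-1); rewrite !inE eqxx !orbT; split=> //; by_coordinates.
- exists D, 1, 0; rewrite !inE eqxx !orbT; split=> //; by_coordinates.
- exists (-1), 1; by_coordinates.
- exists (-1), 0; by_coordinates.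
Qed.

Theorem proposition3p2 (R : realType) (M : metamaterial R)
    (hM : M = kagome R \/ M = rotating_squares R)
    (eta : R) (eta_gt0 : 0 < eta) (k : nat) (k_ge1 : (1 <= k)%N)
    (lambda : 'M[R]_2) (psi u : 'cV[R]_2 -> 'cV[R]_2)
    (hu : periodic_mechanism M eta k lambda psi u) :
  isotropic_compression lambda.
Proof.
case: hM hu => ->; first exact: kagome_isotropic_compression.
exact: rotating_squares_isotropic_compression.
Qed.
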